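(* $(G_c[[r]],\circ,\tau')$ is a separable topological group. The family of functions $d_k$, $k\ge1$, separates points on $G_c[[r]]$. Moreover, $G_c[[r]]$ is contractible to a point, arcwise connected, locally simply and arcwise connected, and residually torsion free nilpotent.
   Context: $G_c[[r]]$ is the set of complex power series $f(r)=r+\sum_{k=1}^\infty d_kr^{k+1}$, each convergent in some open neighbourhood of $0\in\mathbb{C}$, with multiplication $\circ$ given by composition of series. $d_k:G_c[[r]]\to\mathbb{C}$ is the function for which $d_k(f)$ is the $(k+1)$-st coefficient (the coefficient of $r^{k+1}$) of the Taylor expansion of $f$ at $0$. $\tau'$ is the weakest topology on $G_c[[r]]$ in which all functions $d_k$ are continuous. A group $G$ is residually torsion free nilpotent if the set of its finite-dimensional unipotent representations (homomorphisms into unipotent matrix groups over $\mathbb{C}$) separates elements of $G$. ''Locally simply and arcwise connected'' means locally simply connected and locally arcwise connected. *)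

(* Defs.v *)
From HB Require Import structures.
From mathcomp Require Import all_boot all_order all_algebra complex.
From mathcomp Require Import all_classical all_reals all_analysis.

Set Implicit Arguments.
Unset Strict Implicit.
Unset Printing Implicit Defensive.

Import Order.TTheory GRing.Theory Num.Theory.
Import numFieldNormedType.Exports.

Local Open Scope classical_set_scope.
Local Open Scope ring_scope.
Local Open Scope complex_scope.

(* The topology of the complex numbers given by the modulus. *)
HB.instance Definition _ (R : realType) := NormedModule.copy R[i] R[i]^o.

Section FormalSeries.
Variable K : numFieldType.
Implicit Types c e h : nat -> K.

Definition trunc_ps c n : {poly K} := \poly_(i < n.+1) c i.

(* Substitution c(e(r)) of a series without constant term: only the          *)
(* coefficients of index at most n contribute to the coefficient of r^n.     *)
Definition comp_ps c e : nat -> K :=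
  fun n => (trunc_ps c n \Po trunc_ps e n)`_n.

Definition id_ps : nat -> K := fun n => (n == 1)%:R.

Definition inv_iter c j : nat -> K :=
  iter j (fun h n => id_ps n - comp_ps (fun k => c k - id_ps k) h n) (fun=> 0).

(* The compositional inverse of a series c = r + O(r^2), i.e. the solution   *)
(* of h = r - (c - id)(h); the j-th Picard iterate is exact up to r^j.       *)
Definition inv_ps c : nat -> K := fun n => inv_iter c n n.

Definition eq_upto n (p q : nat -> K) := forall i, (i <= n)%N -> p i = q i.

Lemma eqm_mul n (p p' q q' : {poly K}) :
  eq_upto n (nth 0 p) (nth 0 p') -> eq_upto n (nth 0 q) (nth 0 q') ->
  eq_upto n (nth 0 (p * q)) (nth 0 (p' * q')).
Proof.
move=> pp qq i le_in; rewrite !coefM; apply: eq_bigr => j _.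
by rewrite pp ?qq // ?(leq_trans (leq_subr _ _)) // (leq_trans _ le_in) -1?ltnS.
Qed.

Lemma eqm_exp n (p p' : {poly K}) k :
  eq_upto n (nth 0 p) (nth 0 p') -> eq_upto n (nth 0 (p ^+ k)) (nth 0 (p' ^+ k)).
Proof. by move=> pp; elim: k => [//|k IH]; rewrite !exprS; apply: eqm_mul. Qed.

Lemma eqm_mulS n (p p' q q' : {poly K}) :
  p`_0 = 0 -> p'`_0 = 0 -> q`_0 = 0 -> q'`_0 = 0 ->
  eq_upto n (nth 0 p) (nth 0 p') -> eq_upto n (nth 0 q) (nth 0 q') ->
  eq_upto n.+1 (nth 0 (p * q)) (nth 0 (p' * q')).
Proof.
move=> p0 p0' q0 q0' pp qq i; rewrite leq_eqVlt => /predU1P[->|le_in]; last first.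
  by apply: (eqm_mul pp qq); rewrite -ltnS.
rewrite !coefM; apply: eq_bigr => -[[|j] /= jn] _; first by rewrite p0 p0' !mul0r.
move: jn; rewrite !ltnS subSS leq_eqVlt => /predU1P[->|jn].
  by rewrite subnn q0 q0' !mulr0.
by rewrite pp ?qq // leq_subr.
Qed.

Lemma exp_low (q : {poly K}) k j : q`_0 = 0 -> (j < k)%N -> (q ^+ k)`_j = 0.
Proof.
move=> q0; elim: k j => [//|k IH] j jk; rewrite exprS coefM big1 // => -[[|i] /= ij] _.
  by rewrite q0 mul0r.
rewrite IH ?mulr0 //.
by move: ij jk; case: j => // j; rewrite !ltnS subSS => ij jk; rewrite (leq_ltn_trans (leq_subr _ _)).
Qed.

Lemma comp_polyE (p q : {poly K}) n j : q`_0 = 0 -> (j <= n)%N ->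
  (p \Po q)`_j = \sum_(i < n.+1) p`_i * (q ^+ i)`_j.
Proof.
move=> q0 jn; rewrite coef_comp_poly.
pose F i := p`_i * (q ^+ i)`_j.
have big m : (size p <= m)%N -> \sum_(i < size p) F i = \sum_(i < m) F i.
  move=> pm; rewrite (big_ord_widen m) // big_mkcond; apply: eq_bigr => i _.
  by case: ifPn => //; rewrite -leqNgt /F => ?; rewrite nth_default ?mul0r.
have big' m : (n < m)%N -> \sum_(i < n.+1) F i = \sum_(i < m) F i.
  move=> pm; rewrite (big_ord_widen m) // big_mkcond; apply: eq_bigr => i _.
  case: ifPn => //; rewrite -leqNgt /F => ni.
  by rewrite exp_low ?mulr0 // (leq_ltn_trans jn).
rewrite (big (maxn (size p) n.+1)) ?leq_maxl //.
by rewrite [RHS](big' (maxn (size p) n.+1)) ?leq_maxr.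
Qed.

Lemma coef_trunc c n i : (i <= n)%N -> (trunc_ps c n)`_i = c i.
Proof. by move=> ?; rewrite coef_poly ltnS ifT. Qed.

Lemma comp_psE n c e j : e 0%N = 0 -> (j <= n)%N ->
  comp_ps c e j = \sum_(i < n.+1) c i * (trunc_ps e n ^+ i)`_j.
Proof.
move=> e0 jn; have t0 m : (trunc_ps e m)`_0 = 0 by rewrite coef_trunc.
have <- : (trunc_ps c n \Po trunc_ps e n)`_j =
          \sum_(i < n.+1) c i * (trunc_ps e n ^+ i)`_j.
  rewrite (comp_polyE _ _ jn) //; apply: eq_bigr => i _.
  by rewrite coef_trunc // -ltnS.
rewrite /comp_ps !(@comp_polyE _ _ j j) //; apply: eq_bigr => i _.
have ij : (i <= j)%N by rewrite -ltnS.
rewrite !coef_trunc //; last exact: leq_trans jn.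
congr (_ * _); apply: (eqm_exp (n := j)) => // k kj.
by rewrite !coef_trunc // (leq_trans kj).
Qed.

Lemma comp_ps_poly n c e j : e 0%N = 0 -> (j <= n)%N ->
  comp_ps c e j = (trunc_ps c n \Po trunc_ps e n)`_j.
Proof.
move=> e0 jn; rewrite (comp_psE _ _ jn) // (comp_polyE _ _ jn) ?coef_trunc //.
by apply: eq_bigr => i _; rewrite coef_trunc // -ltnS.
Qed.

Lemma eqm_comp_poly n (p p' q q' : {poly K}) : q`_0 = 0 -> q'`_0 = 0 ->
  eq_upto n (nth 0 p) (nth 0 p') -> eq_upto n (nth 0 q) (nth 0 q') ->
  eq_upto n (nth 0 (p \Po q)) (nth 0 (p' \Po q')).
Proof.
move=> q0 q0' pp qq i le_in; rewrite !(comp_polyE _ _ le_in) //.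
apply: eq_bigr => j _; rewrite pp -1?ltnS //; congr (_ * _).
exact: (eqm_exp _ qq).
Qed.

Lemma comp_ps0 c e : c 0%N = 0 -> comp_ps c e 0 = 0.
Proof.
move=> c0; rewrite /comp_ps coef_comp_poly big1 // => -[[|i] /= isz] _.
  by rewrite coef_trunc // c0 mul0r.
by have := leq_trans isz (size_poly _ _).
Qed.

Lemma comp_ps1 c e : e 0%N = 0 -> comp_ps c e 1 = c 1%N * e 1%N.
Proof.
move=> e0; rewrite (comp_psE (n := 1)) // !big_ord_recl big_ord0 expr0 expr1.
by rewrite coef1 mulr0 add0r addr0 coef_trunc.
Qed.

Lemma comp_psA c e h : e 0%N = 0 -> h 0%N = 0 ->
  comp_ps c (comp_ps e h) = comp_ps (comp_ps c e) h.
Proof.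
move=> e0 h0; apply/funext => n.
have eh0 := comp_ps0 h e0.
rewrite (comp_ps_poly c eh0 (leqnn n)) (comp_ps_poly _ h0 (leqnn n)).
have t0 (u : nat -> K) : u 0%N = 0 -> (trunc_ps u n)`_0 = 0.
  by move=> u0; rewrite coef_trunc.
have ehE : eq_upto n (nth 0 (trunc_ps (comp_ps e h) n))
                 (nth 0 (trunc_ps e n \Po trunc_ps h n)).
  by move=> i le_in; rewrite coef_trunc // (comp_ps_poly _ _ le_in).
have ceE : eq_upto n (nth 0 (trunc_ps (comp_ps c e) n))
                 (nth 0 (trunc_ps c n \Po trunc_ps e n)).
  by move=> i le_in; rewrite coef_trunc // (comp_ps_poly _ _ le_in).
transitivity ((trunc_ps c n \Po (trunc_ps e n \Po trunc_ps h n))`_n).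
  apply: (eqm_comp_poly (n := n)) => //; first exact: t0.
  by rewrite -ehE // t0.
rewrite comp_polyA; apply: (eqm_comp_poly (n := n)) => //; try exact: t0.
by move=> i /ceE.
Qed.

Lemma comp_id_ps c : c 0%N = 0 -> comp_ps id_ps c = c.
Proof.
move=> c0; apply/funext => n; rewrite (comp_psE _ c0 (leqnn n)).
case: n => [|n].
  by rewrite !big_ord_recl big_ord0 /id_ps /= mul0r addr0 c0.
rewrite !big_ord_recl big1 ?addr0 => [|i _]; last by rewrite /id_ps /= mul0r.
by rewrite /id_ps /= mul0r add0r mul1r expr1 coef_trunc.
Qed.

Lemma comp_ps_id c : comp_ps c id_ps = c.
Proof.
apply/funext => n; rewrite /comp_ps.
transitivity ((trunc_ps c n \Po 'X)`_n); last by rewrite comp_polyXr coef_trunc.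
apply: (eqm_comp_poly (n := n)); rewrite ?coef_trunc ?coefX // => i le_in.
by rewrite coef_trunc // coefX.
Qed.

Lemma comp_psBl c c' e : e 0%N = 0 ->
  comp_ps (fun k => c k - c' k) e = fun n => comp_ps c e n - comp_ps c' e n.
Proof.
move=> e0; apply/funext => n; rewrite !(comp_psE _ e0 (leqnn n)) -sumrB.
by apply: eq_bigr => i _; rewrite mulrBl.
Qed.

Lemma eqm_comp n c h h' : h 0%N = 0 -> h' 0%N = 0 -> eq_upto n h h' ->
  eq_upto n (comp_ps c h) (comp_ps c h').
Proof.
move=> h0 h0' hh j jn; rewrite !(comp_psE _ _ jn) //.
apply: eq_bigr => i _; congr (_ * _).
by apply: (eqm_exp (n := n)) => // k kn; rewrite !coef_trunc // hh.
Qed.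

Lemma eqm_compS n c h h' : c 0%N = 0 -> c 1%N = 0 -> h 0%N = 0 -> h' 0%N = 0 ->
  eq_upto n h h' -> eq_upto n.+1 (comp_ps c h) (comp_ps c h').
Proof.
move=> c0 c1 h0 h0' hh j jn; rewrite !(comp_psE _ _ jn) //.
apply: eq_bigr => -[[|[|i]] /= _] _; rewrite ?c0 ?c1 ?mul0r //; congr (_ * _).
have t0 (u : nat -> K) : u 0%N = 0 -> (trunc_ps u n.+1)`_0 = 0.
  by move=> u0; rewrite coef_trunc.
have hht : eq_upto n (nth 0 (trunc_ps h n.+1)) (nth 0 (trunc_ps h' n.+1)).
  by move=> k kn; rewrite !coef_trunc ?hh // (leq_trans kn).
rewrite !(exprS _ i.+1); apply: (@eqm_mulS n) => //; try exact: t0.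
- by rewrite exp_low // t0.
- by rewrite exp_low // t0.
- exact: eqm_exp.
Qed.

Lemma inv_iter0 c j : c 0%N = 0 -> inv_iter c j 0 = 0.
Proof.
move=> c0; case: j => //= j; rewrite comp_ps0 /id_ps //= ?c0 subr0 //.
Qed.

Lemma inv_iterS c j : c 0%N = 0 -> c 1%N = 1 ->
  eq_upto j (inv_iter c j.+1) (inv_iter c j).
Proof.
move=> c0 c1; elim: j => [|j IH] i ij.
  by move: ij; rewrite leqn0 => /eqP ->; rewrite !inv_iter0.
rewrite [LHS]/= [RHS]/=; congr (_ - _); apply: (@eqm_compS j) => //.
- by rewrite c0 /id_ps /= subr0.
- by rewrite c1 /id_ps /= subrr.
- exact: (inv_iter0 j.+1).
- exact: inv_iter0.
Qed.

Lemma inv_psE c n : c 0%N = 0 -> c 1%N = 1 -> eq_upto n (inv_ps c) (inv_iter c n).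
Proof.
move=> c0 c1; elim: n => [|n IH] i.
  by rewrite leqn0 => /eqP->.
rewrite leq_eqVlt => /predU1P[->//|ni].
by rewrite IH // inv_iterS.
Qed.

Lemma inv_ps0 c : c 0%N = 0 -> inv_ps c 0 = 0.
Proof. by []. Qed.

Lemma inv_ps1 c : c 0%N = 0 -> c 1%N = 1 -> inv_ps c 1 = 1.
Proof.
by move=> c0 c1; rewrite /inv_ps /= comp_ps1 // mulr0 subr0.
Qed.

Lemma comp_inv_ps c : c 0%N = 0 -> c 1%N = 1 -> comp_ps c (inv_ps c) = id_ps.
Proof.
move=> c0 c1; have i0 := inv_ps0 c0.
have : inv_ps c =
    fun n => id_ps n - comp_ps (fun k => c k - id_ps k) (inv_ps c) n.
  apply/funext => n.
  have -> : inv_ps c n = inv_iter c n.+1 n.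
    by rewrite inv_iterS.
  rewrite /=; congr (_ - _); apply: (@eqm_comp n) => //; first exact: inv_iter0.
  by move=> i ni; rewrite (inv_psE (n := n)).
rewrite comp_psBl // comp_id_ps // => invE; apply/funext => n.
have /eqP := congr1 (fun u => u n) invE; rewrite /= opprB addrCA.
by rewrite -subr_eq0 opprD addrA subrr sub0r oppr_eq0 subr_eq0 => /eqP.
Qed.

Definition norm_ps (t : K) n c := \sum_(i < n.+1) `|c i| * t ^+ i.

Definition bounded_ps c :=
  exists t, exists M, [/\ 0 < t, 0 <= M & forall n, norm_ps t n c <= M].

Lemma norm_mul t n (p q : {poly K}) : 0 <= t ->
  norm_ps t n (nth 0 (p * q)) <= norm_ps t n (nth 0 p) * norm_ps t n (nth 0 q).
Proof.
move=> t0; pose T (u : {poly K}) := \poly_(i < n.+1) (`|u`_i| * t ^+ i).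
have TE (u : {poly K}) : norm_ps t n (nth 0 u) = (T u).[1].
  rewrite (horner_coef_wide 1 (size_poly _ _)); apply: eq_bigr => i _.
  by rewrite expr1n mulr1 coef_poly ltn_ord.
have T0 (u : {poly K}) i : 0 <= (T u)`_i.
  by rewrite coef_poly; case: ifP => // _; rewrite mulr_ge0 // exprn_ge0.
rewrite !TE -hornerM.
have big m : (size (T p * T q)%R <= m)%N ->
    (T p * T q).[1] = \sum_(i < m) (T p * T q)`_i.
  move=> /horner_coef_wide ->; apply: eq_bigr => i _.
  by rewrite expr1n mulr1.
rewrite (big (maxn (size (T p * T q)%R) n.+1)) ?leq_maxl // -TE /norm_ps.
rewrite (big_ord_widen (maxn (size (T p * T q)%R) n.+1)
  (fun i => `|(p * q)`_i| * t ^+ i)) ?leq_maxr // big_mkcond.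
apply: ler_sum => i _; case: ifPn => [le_in|_]; last first.
  by rewrite coefM sumr_ge0 // => j _; rewrite mulr_ge0.
rewrite !coefM (le_trans (ler_wpM2r _ (ler_norm_sum _ _ _))) ?exprn_ge0 //.
rewrite mulr_suml; apply: ler_sum => j _.
have ji : (j <= i)%N by rewrite -ltnS.
rewrite !coef_poly (leq_ltn_trans ji le_in) (leq_ltn_trans (leq_subr _ _) le_in).
by rewrite normrM mulrACA -exprD subnKC.
Qed.

Lemma norm_exp t n (p : {poly K}) k : 0 <= t ->
  norm_ps t n (nth 0 (p ^+ k)) <= norm_ps t n (nth 0 p) ^+ k.
Proof.
move=> t0; elim: k => [|k IH].
  rewrite !expr0 /norm_ps big_ord_recl big1 => [|i _].
    by rewrite coef1 /= normr1 expr0 mulr1 addr0.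
  by rewrite coef1 /= normr0 mul0r.
rewrite !exprS (le_trans (norm_mul _ _ _ t0)) // ler_wpM2l //.
by rewrite sumr_ge0 // => i _; rewrite mulr_ge0 // exprn_ge0.
Qed.

Lemma norm_ge0 t n c : 0 <= t -> 0 <= norm_ps t n c.
Proof. by move=> t0; rewrite sumr_ge0 // => i _; rewrite mulr_ge0 // exprn_ge0. Qed.

Lemma norm_le_base s t n c : 0 <= s -> s <= t -> norm_ps s n c <= norm_ps t n c.
Proof.
move=> s0 st; apply: ler_sum => i _; rewrite ler_wpM2l // lerXn2r //.
by rewrite nnegrE (le_trans s0).
Qed.

Lemma norm_comp t n c e : 0 <= t -> e 0%N = 0 ->
  norm_ps t n (comp_ps c e) <= norm_ps (norm_ps t n e) n c.
Proof.
move=> t0 e0; rewrite /norm_ps.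
under eq_bigr do rewrite (comp_psE (n := n) c e0) -1?ltnS //.
apply: (@le_trans _ _ (\sum_(i < n.+1) \sum_(j < n.+1)
    `|c j| * (`|(trunc_ps e n ^+ j)`_i| * t ^+ i))).
  apply: ler_sum => i _.
  rewrite (le_trans (ler_wpM2r _ (ler_norm_sum _ _ _))) ?exprn_ge0 //.
  by rewrite mulr_suml; apply: ler_sum => j _; rewrite normrM mulrA.
rewrite exchange_big; apply: ler_sum => j _ /=; rewrite -mulr_sumr ler_wpM2l //.
apply: (le_trans (norm_exp n (trunc_ps e n) j t0)).
rewrite lerXn2r ?nnegrE ?norm_ge0 //.
by apply: ler_sum => i _; rewrite coef_trunc // -ltnS.
Qed.

Lemma norm_scale k s t n c : 0 <= s <= 1 -> 0 <= t ->
  (forall i, (i < k)%N -> c i = 0) ->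
  norm_ps (s * t) n c <= s ^+ k * norm_ps t n c.
Proof.
move=> /andP[s0 s1] t0 c0; rewrite mulr_sumr; apply: ler_sum => i _.
have [ik|ki] := ltnP i k; first by rewrite c0 // normr0 !mul0r mulr0.
rewrite exprMn mulrCA ler_wpM2r ?mulr_ge0 ?exprn_ge0 //.
exact: ler_wiXn2l.
Qed.

Lemma bounded_comp_ps c e : e 0%N = 0 ->
  bounded_ps c -> bounded_ps e -> bounded_ps (comp_ps c e).
Proof.
move=> e0 [s [M [s0 M0 cM]]] [t [N [t0 N0 eN]]].
have sN : 0 < N + s by rewrite ltr_wpDl.
have r0 : 0 < s / (N + s) by rewrite divr_gt0.
exists (s / (N + s) * t), M; split=> [||n] //; first by rewrite mulr_gt0.
have rt0 : 0 <= s / (N + s) * t by rewrite mulr_ge0 // ltW.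
apply: (le_trans (norm_comp n c rt0 e0)); apply: (le_trans _ (cM n)).
apply: norm_le_base; first exact: norm_ge0.
apply: (@le_trans _ _ ((s / (N + s)) ^+ 1 * norm_ps t n e)).
  apply: norm_scale (ltW t0) _; last by case.
  by rewrite (ltW r0) ler_pdivrMr // mul1r lerDr.
rewrite expr1 mulrAC ler_pdivrMr // ler_wpM2l ?ltW //.
by rewrite (le_lt_trans (eN n)) // ltrDl.
Qed.

Lemma bounded_id_ps : bounded_ps id_ps.
Proof.
exists 1, 1; split=> // n; rewrite /norm_ps big_ord_recl.
rewrite /id_ps /= normr0 mul0r add0r; case: n => [|n].
  by rewrite big_ord0.
rewrite big_ord_recl big1 ?addr0 => [|i _]; last by rewrite normr0 mul0r.
by rewrite /= normr1 expr1n mulr1.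
Qed.

Lemma bounded_inv_ps c : c 0%N = 0 -> c 1%N = 1 ->
  bounded_ps c -> bounded_ps (inv_ps c).
Proof.
move=> c0 c1 [t [M [t0 M0 cM]]].
pose Q k := c k - id_ps k.
have Q01 i : (i < 2)%N -> Q i = 0.
  by case: i => [|[|//]] _; rewrite /Q /id_ps ?c0 ?c1 subrr.
have QM n : norm_ps t n Q <= M.
  apply: le_trans (cM n); apply: ler_sum => i _.
  have [i2|i2] := ltnP i 2.
    by rewrite Q01 // normr0 mul0r mulr_ge0 // exprn_ge0 // ltW.
  by rewrite /Q /id_ps (gtn_eqF i2) subr0.
have d0 : 0 < t + M * 2 by rewrite ltr_wpDr // mulr_ge0.
pose s := t / (t + M * 2).
have s0 : 0 < s by rewrite divr_gt0.
have s1 : s <= 1 by rewrite ler_pdivrMr // mul1r lerDl mulr_ge0.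
have sM : s * M <= t / 2.
  rewrite mulrAC ler_pdivrMr // -mulrA ler_wpM2l ?(ltW t0) //.
  by rewrite mulrC ler_pdivlMr // lerDr ltW.
pose u := s * t / 2.
have u0 : 0 < u by rewrite /u divr_gt0 ?(mulr_gt0 s0 t0).
have uu : u + u = s * t by rewrite /u -mulr2n -(mulr_natr (s * t / 2)) divfK ?pnatr_eq0.
have iterN j n : norm_ps u n (inv_iter c j) <= u + u.
  elim: j => [|j IH].
    rewrite /norm_ps big1 ?addr_ge0 ?(ltW u0) // => i _.
    by rewrite /= normr0 mul0r.
  apply: (@le_trans _ _ (norm_ps u n id_ps + norm_ps u n (comp_ps Q (inv_iter c j)))).
    rewrite -big_split; apply: ler_sum => i _ /=.
    by rewrite -mulrDl ler_wpM2r ?exprn_ge0 ?(ltW u0) ?ler_normB.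
  apply: lerD.
    rewrite /norm_ps big_ord_recl /id_ps /= normr0 mul0r add0r.
    case: n {IH} => [|n]; first by rewrite big_ord0 ltW.
    rewrite big_ord_recl big1 ?addr0 => [|i _]; last by rewrite normr0 mul0r.
    by rewrite /= normr1 mul1r.
  apply: (le_trans (norm_comp n Q (ltW u0) (inv_iter0 j c0))).
  apply: (@le_trans _ _ (norm_ps (s * t) n Q)).
    by apply: norm_le_base; [apply: norm_ge0; exact: ltW|rewrite -uu].
  apply: (le_trans (@norm_scale 2 s t n Q _ (ltW t0) Q01)).
    by rewrite (ltW s0).
  rewrite expr2 -mulrA /u -mulrA ler_wpM2l ?(ltW s0) //.
  by apply: le_trans sM; rewrite ler_wpM2l ?(ltW s0).
exists u, (u + u); split=> [||n] //; first by rewrite addr_ge0 ?ltW.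
apply: le_trans (iterN n n); apply: ler_sum => i _.
by rewrite (inv_psE (n := n)) // -ltnS.
Qed.

End FormalSeries.

(* Keeps unification from unfolding polynomial arithmetic. *)
Global Opaque comp_ps inv_ps.

Section ConvergentSeries.
Variable R : realType.
Local Notation C := R[i].
Implicit Types c : nat -> C.

Definition convergent_ps c :=
  \forall z \near (0 : C), cvgn [series c n * z ^+ n]_n.

Lemma real_complex_continuous : continuous (real_complex R : R -> C).
Proof.
move=> x; apply/cvgrPdist_lt => e; case: e => er ei; rewrite ltcE /= => /andP[/eqP -> er0].
near=> y; rewrite -rmorphB normc_def /= expr0n /= addr0 sqrtr_sqr ltcR.
by near: y; exact: cvgr_dist_lt.
Unshelve. all: by end_near. Qed.

Lemma cvg_series_complex (w : nat -> C) :
  cvgn (series (fun n => complex.Re (w n))) ->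
  cvgn (series (fun n => complex.Im (w n))) -> cvgn (series w).
Proof.
move=> /cvg_ex[/= a wa] /cvg_ex[/= b wb].
apply/cvg_ex; exists (a%:C + 'i%C * b%:C).
have -> : series w = (fun n => (series (fun n => complex.Re (w n)) n)%:C +
    'i%C * (series (fun n => complex.Im (w n)) n)%:C).
  apply/funext => n; rewrite /series /= !rmorph_sum mulr_sumr -big_split /=.
  by apply: eq_bigr => i _; rewrite -complexE.
apply: cvgD; last apply: cvgM; [|exact: cvg_cst|];
  by apply: continuous_cvg => //; exact: real_complex_continuous.
Qed.

Lemma bounded_convergent_ps c : bounded_ps c -> convergent_ps c.
Proof.
move=> [t [M [t0 M0 cM]]]; near=> z.
have zt : `|z| < t.
  by near: z; apply: (@cvgr0_norm_lt _ _ _ (nbhs (0 : C)) _ id).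
pose b n : R := complex.Re (`|c n| * t ^+ n).
have bE n : (b n)%:C = `|c n| * t ^+ n.
  by rewrite RRe_real // ger0_real // mulr_ge0 // exprn_ge0 // ltW.
have b0 n : 0 <= b n by rewrite -ler0c bE mulr_ge0 // exprn_ge0 // ltW.
have cb : cvgn (series b).
  apply: nondecreasing_is_cvgn; first exact: nondecreasing_series.
  exists (complex.Re M) => _ [n _ <-].
  rewrite -lecR RRe_real ?ger0_real // (le_trans _ (cM n)) //.
  rewrite /norm_ps /series /= big_mkord rmorph_sum big_ord_recr /= ler_wpDr //.
    by rewrite mulr_ge0 // exprn_ge0 // ltW.
  by apply: ler_sum => i _; rewrite bE.
have wb n : `|c n * z ^+ n| <= (b n)%:C.
  rewrite bE normrM normrX ler_wpM2l // lerXn2r ?nnegrE ?(ltW zt) //.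
  exact: ltW.
apply: cvg_series_complex; apply: normed_cvg;
  apply: (series_le_cvg _ b0 _ cb) => n //=; rewrite -lecR (le_trans _ (wb n)) //.
- exact: normc_ge_Re.
- by rewrite [leRHS]normc_def lecR -sqrtr_sqr ler_wsqrtr // lerDr sqr_ge0.
Unshelve. all: by end_near. Qed.

Lemma convergent_bounded_ps c : convergent_ps c -> bounded_ps c.
Proof.
move=> [e /= e0 ce].
have h0 : 0 < e / 2 by rewrite divr_gt0.
pose z := e / 2.
have /ce /cvg_series_cvg_0 cz : ball (0 : C) e z.
  by rewrite -ball_normE /= sub0r normrN gtr0_norm // ltr_pdivrMr // mulr_natr mulr2n ltrDl.
have [N _ cN] : \forall n \near \oo, `|c n * z ^+ n| < 1 by exact: cvgr0_norm_lt.
pose B := 1 + \sum_(i < N) `|c i * z ^+ i|.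
have B0 : 0 <= B by rewrite addr_ge0 // sumr_ge0.
have cB n : `|c n| * z ^+ n <= B.
  rewrite -(@ger0_norm _ (z ^+ n)) ?exprn_ge0 ?(ltW h0) // -normrM.
  have [nN|Nn] := ltnP n N.
    rewrite /B (bigD1 (Ordinal nN)) //= addrCA ler_wpDr //.
    by rewrite addr_ge0 // sumr_ge0.
  by rewrite ler_wpDr ?sumr_ge0 // ltW // cN.
exists (z / 2), (B * 2); split=> [||n]; first by rewrite divr_gt0.
  by rewrite mulr_ge0.
have geo m : \sum_(i < m) (2^-1 : C) ^+ i = 2 - 2 * 2^-1 ^+ m.
  elim: m => [|m IH]; first by rewrite big_ord0 expr0 mulr1 subrr.
  rewrite big_ord_recr /= IH exprS mulrA divff ?pnatr_eq0 // mul1r mulr_natl.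
  by rewrite mulr2n opprD addrA subrK.
apply: (@le_trans _ _ (\sum_(i < n.+1) B * 2^-1 ^+ i)).
  by apply: ler_sum => i _; rewrite exprMn mulrA ler_wpM2r // exprn_ge0.
by rewrite -mulr_sumr ler_wpM2l // geo lerBlDr lerDl mulr_ge0 // exprn_ge0.
Qed.

(* The group G_c[[r]]; coef n is the coefficient of r^n, so that the d_k of  *)
(* f(r) = r + \sum_(k >= 1) d_k r^(k+1) is coef k.+1.                        *)
Record Gc := MkGc {
  coef :> nat -> C;
  coef_0 : coef 0 = 0;
  coef_1 : coef 1 = 1;
  coef_convergent : convergent_ps coef }.

Lemma coef_inj : injective coef.
Proof.
move=> [f f0 f1 fc] [g g0 g1 gc] /= fg.
by case: _ / fg g0 g1 gc => *; congr MkGc; exact: Prop_irrelevance.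
Qed.

HB.instance Definition _ := gen_eqMixin Gc.
HB.instance Definition _ := gen_choiceMixin Gc.

Fact Gc_mul_0 (f g : Gc) : comp_ps f g 0 = 0.
Proof. by rewrite comp_ps0 // coef_0. Qed.

Fact Gc_mul_1 (f g : Gc) : comp_ps f g 1 = 1.
Proof. by rewrite comp_ps1 ?coef_0 // !coef_1 mulr1. Qed.

Fact Gc_mul_convergent (f g : Gc) : convergent_ps (comp_ps f g).
Proof.
apply: bounded_convergent_ps; apply: bounded_comp_ps; first exact: coef_0.
  exact/convergent_bounded_ps/coef_convergent.
exact/convergent_bounded_ps/coef_convergent.
Qed.

Definition Gc_mul (f g : Gc) : Gc :=
  MkGc (Gc_mul_0 f g) (Gc_mul_1 f g) (Gc_mul_convergent f g).

Definition Gc_one : Gc :=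
  @MkGc (@id_ps C) erefl erefl (bounded_convergent_ps (bounded_id_ps C)).

Fact Gc_inv_convergent (f : Gc) : convergent_ps (inv_ps f).
Proof.
apply: bounded_convergent_ps; apply: bounded_inv_ps; rewrite ?coef_0 ?coef_1 //.
exact/convergent_bounded_ps/coef_convergent.
Qed.

Definition Gc_inv (f : Gc) : Gc :=
  MkGc (inv_ps0 (coef_0 f)) (inv_ps1 (coef_0 f) (coef_1 f))
       (Gc_inv_convergent f).

Fact Gc_mulA : associative Gc_mul.
Proof.
by move=> f g h; apply: coef_inj; apply: comp_psA; exact: coef_0.
Qed.

Fact Gc_mul1g : left_id Gc_one Gc_mul.
Proof. by move=> f; apply: coef_inj; apply: comp_id_ps; exact: coef_0. Qed.

Fact Gc_mulg1 : right_id Gc_one Gc_mul.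
Proof. by move=> f; apply: coef_inj; exact: comp_ps_id. Qed.

Fact Gc_mulgV : right_inverse Gc_one Gc_inv Gc_mul.
Proof.
by move=> f; apply: coef_inj; apply: comp_inv_ps; [exact: coef_0|exact: coef_1].
Qed.

Fact Gc_mulVg : left_inverse Gc_one Gc_inv Gc_mul.
Proof.
move=> f; have VV := Gc_mulgV (Gc_inv f); set g := Gc_inv (Gc_inv f) in VV.
rewrite -[LHS]Gc_mulg1 -[X in Gc_mul _ X = _]VV Gc_mulA.
by rewrite -(Gc_mulA (Gc_inv f) f) Gc_mulgV Gc_mulg1.
Qed.

HB.instance Definition _ :=
  isGroup.Build Gc Gc_mulA Gc_mul1g Gc_mulg1 Gc_mulVg Gc_mulgV.

Definition d_ (k : nat) (f : Gc) : C := f k.+1.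

(* tau': the supremum of the initial topologies of the d_k, k >= 1.           *)
HB.instance Definition _ := Topological.copy Gc
  (sup_topology (fun k : nat => Topological.on (initial_topology (d_ k.+1)))).

End ConvergentSeries.

Definition separable (T : topologicalType) :=
  exists2 D : set T, countable D & dense D.

(* The ambient real field R only serves to provide the unit interval.         *)
Section Homotopy.
Variables (R : realType) (T : topologicalType).
Implicit Types (A : set T) (x y : T) (gamma : R -> T).

Definition contractible_to_point := exists (x0 : T) (H : R * T -> T),
  [/\ {within `[0, 1] `*` setT, continuous H},
      forall x, H (0, x) = x
    & forall x, H (1, x) = x0].

Definition path_in A x y gamma :=
  [/\ {within `[0, 1], continuous gamma}, gamma 0 = x, gamma 1 = y
    & gamma @` `[0, 1] `<=` A].

(* An arc is a path which is a homeomorphism onto its image.                  *)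
Definition arc_in A x y gamma :=
  path_in A x y gamma /\
  exists2 delta : T -> R, {within gamma @` `[0, 1], continuous delta}
                        & {in `[0, 1], cancel gamma delta}.

Definition arcwise_connected A :=
  forall x y, A x -> A y -> x <> y -> exists gamma, arc_in A x y gamma.

Definition null_homotopic_in A x gamma := exists H : R * R -> T,
  [/\ {within `[0, 1] `*` `[0, 1], continuous H},
      H @` (`[0, 1] `*` `[0, 1]) `<=` A,
      {in `[0, 1], forall t, H (0, t) = gamma t},
      {in `[0, 1], forall t, H (1, t) = x}
    & {in `[0, 1], forall s, H (s, 0) = x /\ H (s, 1) = x}].

Definition simply_connected A :=
  (forall x y, A x -> A y -> exists gamma, path_in A x y gamma) /\
  (forall x gamma, path_in A x x gamma -> null_homotopic_in A x gamma).

(* The open sets satisfying P form a base of the topology.                    *)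
Definition has_base_of (P : set T -> Prop) := forall x (U : set T),
  nbhs x U -> exists V : set T, [/\ open V, V x, V `<=` U & P V].

Definition locally_arcwise_connected := has_base_of arcwise_connected.

Definition locally_simply_connected := has_base_of simply_connected.

End Homotopy.

Section Unipotent.
Variables (R : realType) (G : groupType).

Definition unipotent n (A : 'M[R[i]]_n) :=
  exists m : nat, (A - 1%:M) ^+ m = 0.

Definition unipotent_representation n (rho : G -> 'M[R[i]]_n) :=
  [/\ rho 1%g = 1%:M,
      forall x y, rho (x * y)%g = rho x *m rho y
    & forall x, unipotent (rho x)].

Definition residually_torsion_free_nilpotent := forall x y : G, x <> y ->
  exists n (rho : G -> 'M[R[i]]_n),
    unipotent_representation rho /\ rho x <> rho y.

End Unipotent.

(* Main.v *)
Require Import Defs.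
From mathcomp Require Import all_boot all_order all_algebra complex.
From mathcomp Require Import all_classical all_reals all_analysis.
From mathcomp Require Import ring lra zify.

Set Implicit Arguments.
Unset Strict Implicit.
Unset Printing Implicit Defensive.

Import Order.TTheory GRing.Theory Num.Theory.
Import numFieldNormedType.Exports.

Local Open Scope classical_set_scope.
Local Open Scope ring_scope.

(* In the coefficients of f and g, each coefficient of f o g and of the inverse
   of f is a polynomial, so the group operations are continuous, and the sets
   fixing finitely many coefficients up to e form a base of the topology. These
   sets, like the whole group, are convex in the affine space of coefficients:
   the homotopy (1 - t) f + t g contracts them, straight segments are arcs, and
   polynomials with coefficients in Q + iQ are dense. Finally,
   composition acts on C[[r]] modulo r^(n+1) by unitriangular matrices, and
   the row of the basis vector r reads off the coefficients of f. *)

(** * Coefficientwise convergence and continuity of the group operations *)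

Section CoefficientTopology.
Variable R : realType.
Local Notation C := R[i].
Implicit Types (f g : Gc R) (n : nat).

Lemma coef_continuous n : continuous (fun f => f n).
Proof.
case: n => [|[|k]].
- rewrite (_ : (fun f => f 0%N) = cst 0); first exact: cst_continuous.
  by apply/funext => f; exact: coef_0.
- rewrite (_ : (fun f => f 1%N) = cst 1); first exact: cst_continuous.
  by apply/funext => f; exact: coef_1.
move=> f; have /cvg_sup/(_ k) fk : nbhs f --> f by [].
move=> A fA; apply: fk; exact: (@initial_continuous (Gc R) C (d_ k.+1) f A fA).
Qed.

(** A supremum of initial topologies tests convergence on each [d_k]; the coefficients of index 0
    and 1 are constant and add no condition. *)
Lemma cvg_GcP (F : set_system (Gc R)) f : Filter F ->
  F --> f <-> forall n, (fun g => g n) @ F --> f n.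
Proof.
move=> FF; split=> [Ff n|Ff].
  by move=> A /(@coef_continuous n f) fA; exact: Ff.
apply/cvg_sup => k A /= -[_ [[B Bop <-] Bf] BA].
by apply: filterS BA _; apply: (Ff k.+2); exact: open_nbhs_nbhs.
Qed.

Lemma cvg_to_GcP (T : Type) (F : set_system T) (u : T -> Gc R) f : Filter F ->
  u @ F --> f <-> forall n, (fun a => u a n) @ F --> f n.
Proof. by move=> FF; rewrite cvg_GcP. Qed.

Lemma cvg_coef_exp (T : Type) (F : set_system T) (p : T -> {poly C})
    (q : {poly C}) i j : Filter F ->
  (forall k, (fun a => (p a)`_k) @ F --> q`_k) ->
  (fun a => (p a ^+ i)`_j) @ F --> (q ^+ i)`_j.
Proof.
move=> FF pq; elim: i j => [|i IH] j; first exact: cvg_cst.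
under eq_fun do rewrite exprS coefM.
rewrite exprS coefM; apply: cvg_big => [|k _]; [exact: add_continuous|exact: cvgM].
Qed.

(** Stated for plain sequences because the recursion for the inverse composes series outside the
    group, such as [f] minus the identity. *)
Lemma cvg_comp_ps (T : Type) (F : set_system T) (c e : T -> nat -> C)
    (c' e' : nat -> C) n : Filter F ->
  (forall a, e a 0%N = 0) -> e' 0%N = 0 ->
  (forall k, (fun a => c a k) @ F --> c' k) ->
  (forall k, (fun a => e a k) @ F --> e' k) ->
  (fun a => comp_ps (c a) (e a) n) @ F --> comp_ps c' e' n.
Proof.
move=> FF e0 e'0 cc ee.
under eq_fun do rewrite (comp_psE _ (e0 _) (leqnn n)).
rewrite (comp_psE _ e'0 (leqnn n)); apply: cvg_big => [|i _]; first exact: add_continuous.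
apply: cvgM => //; apply: cvg_coef_exp => k.
under eq_fun do rewrite coef_poly.
by rewrite coef_poly; case: ifP => _; [exact: ee|exact: cvg_cst].
Qed.

Lemma Gc_mul_continuous : continuous (fun p : Gc R * Gc R => (p.1 * p.2)%g).
Proof.
move=> [f g]; apply/cvg_to_GcP => n.
apply: cvg_comp_ps => [p||k|k]; try exact: coef_0.
  exact: (cvg_comp fst (fun f => f k) cvg_fst (@coef_continuous k f)).
exact: (cvg_comp snd (fun f => f k) cvg_snd (@coef_continuous k g)).
Qed.

Lemma Gc_inv_continuous : continuous (fun f : Gc R => (f^-1)%g).
Proof.
move=> f; apply/(cvg_to_GcP _ _ (nbhs_filter f)) => n.
(* By definition, coefficient [n] of the inverse is that of the [n]-th Picard iterate. All
   coefficients [k] are treated at once, since the next iterate depends on several of them. *)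
suff iter_cvg (F : set_system (Gc R)) (j k : nat) : Filter F -> F --> f ->
    (fun g : Gc R => Defs.inv_iter g j k) @ F --> Defs.inv_iter f j k.
  exact: (iter_cvg (nbhs f) n n (nbhs_filter f)).
move=> FF /cvg_GcP Ff; elim: j k => [|j IH] k; first exact: cvg_cst.
apply: (@cvgB _ C^o _ F _ (cst (id_ps C k))
  (fun g : Gc R => comp_ps (fun i => g i - id_ps C i) (Defs.inv_iter g j) k)).
  exact: cvg_cst.
apply: (@cvg_comp_ps _ F (fun g i => g i - id_ps C i)
    (fun g => Defs.inv_iter g j)) => [a||m|m].
- exact/inv_iter0/coef_0.
- exact/inv_iter0/coef_0.
- by apply: cvgB; [exact: Ff|exact: cvg_cst].
- exact: IH.
Qed.

(** The radius is complex because the norm is complex-valued; [0 < e] forces it to be real. *)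
Definition box f n (e : C) : set (Gc R) :=
  [set g | forall k, (k <= n)%N -> `|f k - g k| < e].

Lemma box_center f n (e : C) : 0 < e -> box f n e f.
Proof. by move=> e0 k _; rewrite subrr normr0. Qed.

Lemma open_box f n (e : C) : open (box f n e).
Proof.
have open_coef k : open [set g : Gc R | `|f k - g k| < e].
  rewrite (_ : [set _ | _] = (fun g : Gc R => g k) @^-1` ball (f k) e).
    by apply: open_comp => [g _|]; [exact: coef_continuous|exact: ball_open].
  by rewrite -ball_normE.
elim: n => [|n IH].
  rewrite (_ : box f 0 e = [set g | `|f 0%N - g 0%N| < e]).
    exact: open_coef.
  by apply/seteqP; split=> g fg; [exact: fg|move=> k; rewrite leqn0 => /eqP->].
rewrite (_ : box f n.+1 e = box f n e `&` [set g | `|f n.+1 - g n.+1| < e]).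
  by apply: openI => //; exact: open_coef.
apply/seteqP; split=> [g fg|g [fg fgn] k].
  by split=> [k kn|]; apply: fg => //; exact: leqW.
by rewrite leq_eqVlt => /predU1P[->|]; [|exact: fg].
Qed.

(** The boxes around [f] generate a filter that converges to [f] in every coefficient, so it
    contains each neighbourhood of [f]. *)
Lemma box_base f (U : set (Gc R)) : nbhs f U ->
  exists n, exists2 e : C, 0 < e & box f n e `<=` U.
Proof.
pose F := filter_from [set p : nat * C | 0 < p.2] (fun p => box f p.1 p.2).
have FF : Filter F.
  apply: filter_from_filter; first by exists (0%N, 1) => /=.
  move=> [n e] [m d] /= e0 d0.
  (* The order on the complex numbers is partial, but positive radii are comparable, so this is
     their minimum. *)
  exists (maxn n m, if e <= d then e else d) => /=; first by case: ifP.
  have ed : e >=< d by apply: real_comparable; exact: gtr0_real.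
  move=> g fg; split=> k kn; have := fg k;
    rewrite leq_max kn ?orbT => /(_ isT) /lt_le_trans; apply.
    by case: (comparable_leP ed) => // /ltW.
  by case: (comparable_leP ed).
suff Ff : F --> f by move=> /Ff[[n e] /= e0 bU]; exists n, e.
apply/cvg_GcP => n; apply/cvgrPdist_lt => e e0.
by exists (n, e) => //= g; exact.
Qed.

End CoefficientTopology.

(** * Straight segments, contractions and convex sets *)

Section Segments.
Variable R : realType.
Local Notation C := R[i].
Implicit Types (f g h : Gc R) (t s : R) (n : nat).

Lemma convergent_psD (c e : nat -> C) :
  convergent_ps c -> convergent_ps e -> convergent_ps (fun n => c n + e n).
Proof.
apply: filterS2 => z zc ze.
rewrite (_ : [series _]_n = [series c n * z ^+ n]_n + [series e n * z ^+ n]_n).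
  exact: (is_cvgD zc ze).
apply/funext => n; rewrite /series /= fctE -big_split /=.
by apply: eq_bigr => i _; rewrite mulrDl.
Qed.

Lemma convergent_psZ (a : C) (c : nat -> C) :
  convergent_ps c -> convergent_ps (fun n => a * c n).
Proof.
apply: filterS => z zc.
rewrite (_ : [series _]_n = (fun n => a * [series c n * z ^+ n]_n n)).
  exact: (is_cvgM (is_cvg_cst a) zc).
apply/funext => n; rewrite /series /= mulr_sumr.
by apply: eq_bigr => i _; rewrite mulrA.
Qed.

Definition seg_ps (t : R) f g n : C := (1 - t%:C%C) * f n + t%:C%C * g n.

Fact seg_ps0 t f g : seg_ps t f g 0 = 0.
Proof. by rewrite /seg_ps !coef_0 !mulr0 addr0. Qed.

Fact seg_ps1 t f g : seg_ps t f g 1 = 1.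
Proof. by rewrite /seg_ps !coef_1 !mulr1 subrK. Qed.

Fact seg_ps_convergent t f g : convergent_ps (seg_ps t f g).
Proof.
by apply: convergent_psD; apply: convergent_psZ; exact: coef_convergent.
Qed.

Definition seg t f g : Gc R :=
  MkGc (seg_ps0 t f g) (seg_ps1 t f g) (seg_ps_convergent t f g).

Lemma seg0 f g : seg 0 f g = f.
Proof.
by apply/coef_inj/funext => n; rewrite /= /seg_ps subr0 mul1r mul0r addr0.
Qed.

Lemma seg1 f g : seg 1 f g = g.
Proof.
by apply/coef_inj/funext => n; rewrite /= /seg_ps subrr mul0r mul1r add0r.
Qed.

Lemma seg_id t f : seg t f f = f.
Proof.
by apply/coef_inj/funext => n; rewrite /= /seg_ps -mulrDl subrK mul1r.
Qed.

(** An arbitrary filter covers both full neighbourhoods and those relative to the unit square. *)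
Lemma cvg_seg (T : Type) (F : set_system T) (u : T -> R) (v w : T -> Gc R) t f g :
  Filter F -> u @ F --> t -> v @ F --> f -> w @ F --> g ->
  (fun a => seg (u a) (v a) (w a)) @ F --> seg t f g.
Proof.
move=> FF ut /cvg_to_GcP vf /cvg_to_GcP wg; apply/cvg_to_GcP => n.
have uC : (fun a => (u a)%:C%C : C) @ F --> t%:C%C.
  by apply: continuous_cvg ut; exact: real_complex_continuous.
have uN : (fun a => 1 - (u a)%:C%C : C) @ F --> 1 - t%:C%C.
  exact: (cvgB (cvg_cst (1 : C)) uC).
exact: (cvgD (cvgM uN (vf n)) (cvgM uC (wg n))).
Qed.

Lemma seg_continuous f g : continuous (fun t => seg t f g).
Proof. by move=> t; apply: cvg_seg; [exact: cvg_id|exact: cvg_cst|exact: cvg_cst]. Qed.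

Definition seg_convex (A : set (Gc R)) :=
  forall f g t, A f -> A g -> 0 <= t <= 1 -> A (seg t f g).

Lemma setT_seg_convex : seg_convex setT.
Proof. by []. Qed.

Lemma box_seg_convex f n (e : C) : seg_convex (box f n e).
Proof.
move=> g h t fg fh /andP[t0 t1] k kn.
have tE : f k - seg t g h k = (1 - t)%:C%C * (f k - g k) + t%:C%C * (f k - h k).
  rewrite /= /seg_ps rmorphB /= rmorph1; ring.
have eE : e = (1 - t)%:C%C * e + t%:C%C * e.
  by rewrite -mulrDl -rmorphD subrK mul1r.
have nC (x : R) : 0 <= x -> `|x%:C%C : C| = x%:C%C.
  by move=> x0; rewrite ger0_norm ?ler0c.
rewrite tE eE (le_lt_trans (ler_normD _ _)) // !normrM !nC ?subr_ge0 //.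
(* For [t] nonzero the strict inequality comes from the [h] term; at [t = 0] that term vanishes and
   [g] must supply it. *)
have [->|tn0] := eqVneq t 0.
  by rewrite subr0 !mul0r !addr0 !mul1r fg.
apply: ler_ltD; first by rewrite ler_wpM2l ?ler0c ?subr_ge0 // ltW // fg.
by rewrite ltr_pM2l ?fh // (ltcR 0 t) lt_neqAle eq_sym tn0.
Qed.

Lemma seg_path_in (A : set (Gc R)) f g : seg_convex A -> A f -> A g ->
  path_in A f g (fun t => seg t f g).
Proof.
move=> cA Af Ag; split; rewrite ?seg0 ?seg1 //.
  by apply: continuous_subspaceT; exact: seg_continuous.
by move=> _ [t + <-]; rewrite /= in_itv => t01; exact: cA.
Qed.

Lemma Gc_neq f g : f <> g -> exists k, d_ k.+1 f <> d_ k.+1 g.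
Proof.
move=> fg; apply: contrapT => /forallNP fgE; apply: fg.
apply/coef_inj/funext => -[|[|k]]; rewrite ?coef_0 ?coef_1 //.
by have /contrapT := fgE k.
Qed.

Lemma Re_continuous : continuous (@complex.Re R : C -> R).
Proof.
move=> x A /nbhs_ballP[e /= e0 eA].
exists e%:C%C => [|y xy]; first by rewrite /= (ltcR 0 e).
apply: eA; rewrite -ball_normE /= -raddfB -ltcR.
by apply: le_lt_trans xy; exact: normc_ge_Re.
Qed.

(* The inverse of the segment reads the parameter off a coefficient. *)
Lemma seg_convex_arcwise (A : set (Gc R)) : seg_convex A -> arcwise_connected R A.
Proof.
move=> cA f g Af Ag /Gc_neq[k fgk].
exists (fun t => seg t f g); split; first exact: seg_path_in.
exists (fun h => complex.Re ((h k.+2 - f k.+2) / (g k.+2 - f k.+2))).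
  apply: continuous_subspaceT => h.
  apply: (@continuous_comp _ _ _ (fun h : Gc R => (h k.+2 - f k.+2) / (g k.+2 - f k.+2)));
    last exact: Re_continuous.
  have FF : Filter (nbhs h) by exact: nbhs_filter.
  have hk : (fun h : Gc R => h k.+2) @ nbhs h --> h k.+2 := @coef_continuous _ _ h.
  have /(_ FF FF FF FF) := cvgM (cvgB hk (cvg_cst (f k.+2)))
                                (cvg_cst (g k.+2 - f k.+2)^-1).
  exact.
move=> t _; rewrite /= /seg_ps.
rewrite (_ : _ - _ = t%:C%C * (g k.+2 - f k.+2)); last by ring.
by rewrite mulfK // subr_eq0 eq_sym; apply/eqP.
Qed.

(** Each point of a loop moves along the segment to the base point; the ends of the loop stay fixed,
    since a segment from [f] to [f] is constant. *)
Lemma seg_convex_simply_connected (A : set (Gc R)) :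
  seg_convex A -> simply_connected R A.
Proof.
move=> cA; split=> [f g Af Ag|f gamma [cg g0 g1 gA]].
  by exists (fun t => seg t f g); exact: seg_path_in.
have Af : A f by apply: gA; exists 0 => //=; rewrite in_itv /= lexx ler01.
exists (fun p => seg p.1 (gamma p.2) f); split.
- apply/subspace_continuousP => -[s t] [/= Is It].
  apply: cvg_seg; [|move/subspace_continuousP: cg => /(_ t It) cg|exact: cvg_cst].
    by apply: cvg_within_filter; exact: cvg_fst.
  (* [gamma] is continuous only relative to the unit interval, so its neighbourhood condition is
     pulled back along the second projection and restricted to the square. *)
  move=> B /cg gB.
  have tB : nbhs t [set b | `[0, 1]%classic b -> B (gamma b)] := gB.
  have nB : nbhs (s, t) [set p | `[0, 1]%classic p.2 -> B (gamma p.2)].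
    exact: (@cvg_snd _ _ (nbhs s) (nbhs t) _ _ tB).
  have FF : Filter (nbhs (s, t)) by exact: nbhs_filter.
  have : nbhs (s, t) [set p | (`[0, 1] `*` `[0, 1]) p -> B (gamma p.2)].
    by apply: filterS nB => p pB [_ /pB].
  exact.
- move=> _ [[s t] [/= Is It] <-].
  by apply: cA => //; apply: gA; exists t.
- by move=> t _; exact: seg0.
- by move=> t _; exact: seg1.
- by move=> s _; rewrite /= g0 g1 seg_id.
Qed.

Lemma Gc_contractible : contractible_to_point R (Gc R).
Proof.
exists 1%g, (fun p => seg p.1 p.2 1%g); split=> [|f|f]; rewrite ?seg0 ?seg1 //.
apply: continuous_subspaceT => -[t f].
by apply: cvg_seg; [exact: cvg_fst|exact: cvg_snd|exact: cvg_cst].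
Qed.

Lemma has_base_of_box (P : set (Gc R) -> Prop) :
  (forall A, seg_convex A -> P A) -> has_base_of P.
Proof.
move=> cP f U /box_base[n [e e0 bU]]; exists (box f n e); split=> //.
- exact: open_box.
- exact: box_center.
- by apply: cP; exact: box_seg_convex.
Qed.

End Segments.

(** * A countable dense set of polynomials *)

Section Separability.
Variable R : realType.
Local Notation C := R[i].

Lemma finite_support_convergent (c : nat -> C) N :
  (forall n, (N <= n)%N -> c n = 0) -> convergent_ps c.
Proof.
move=> c0; apply: bounded_convergent_ps; exists 1, (\sum_(i < N) `|c i|).
split=> // [|n]; first exact: sumr_ge0.
rewrite (big_ord_widen (maxn N n.+1) (fun i => `|c i|)) ?leq_maxl //.
rewrite /norm_ps (big_ord_widen (maxn N n.+1) (fun i => `|c i| * 1 ^+ i)) ?leq_maxr //.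
rewrite big_mkcond [leRHS]big_mkcond /=; apply: ler_sum => i _.
rewrite expr1n mulr1; have [iN|Ni] := ltnP i N; first by case: ifP.
by rewrite c0 // normr0; case: ifP.
Qed.

Definition gauss_rat (q : rat * rat) : C := (ratr q.1 +i* ratr q.2)%C.

Lemma gauss_rat_dense (z e : C) : 0 < e -> exists q, `|z - gauss_rat q| < e.
Proof.
move=> e0; case: z => a b.
have eE : e = (complex.Re e)%:C%C by rewrite RRe_real ?gtr0_real.
move: (complex.Re e) eE e0 => r ->; rewrite (ltcR 0 r) => r0.
(* Two errors below [r / 2] give a squared modulus below [r ^+ 2 / 2]. *)
have approx (x : R) : exists q : rat, `|x - ratr q| < r / 2.
  have [|q] := @rat_in_itvoo R (x - r / 2) (x + r / 2); first by lra.
  by rewrite in_itv /= => xq; exists q; rewrite ltr_norml; lra.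
have [p ap] := approx a; have [q bq] := approx b.
exists (p, q); rewrite normc_def ltcR /= -[ltRHS](gtr0_norm r0) -sqrtr_sqr.
rewrite ltr_sqrt ?exprn_gt0 //; move: ap bq; rewrite !ltr_norml => ap bq; nra.
Qed.

Definition gauss_ps (s : seq (rat * rat)) n : C :=
  if n is k.+2 then gauss_rat (nth (0, 0) s k) else n%:R.

Fact gauss_ps_convergent s : convergent_ps (gauss_ps s).
Proof.
apply: (@finite_support_convergent _ (size s).+2) => -[|[|k]] //=.
by rewrite !ltnS => sk; rewrite nth_default // /gauss_rat /= rmorph0.
Qed.

Definition gauss_Gc s : Gc R :=
  @MkGc R (gauss_ps s) erefl erefl (gauss_ps_convergent s).

Lemma Gc_separable : separable (Gc R).
Proof.
exists (range gauss_Gc); first exact: (sub_countable (card_image_le _ _) (countableP _)).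
move=> U [f Uf] Uo; have /box_base[n [e e0 bU]] := open_nbhs_nbhs (conj Uo Uf).
have /choice[q fq] k : exists q, `|f k.+2 - gauss_rat q| < e.
  exact: gauss_rat_dense.
(* The [n] entries fill the indices 2 to [n.+1], which covers the box. *)
exists (gauss_Gc (mkseq q n)); split; last by exists (mkseq q n).
apply: bU => -[|[|k]] kn; rewrite /= ?coef_0 ?coef_1 ?subrr ?normr0 //.
by rewrite nth_mkseq // ltnW.
Qed.

End Separability.

(** * Unipotent representations by composition of truncated series *)

Section Representations.
Variable R : realType.
Local Notation C := R[i].

(* Composition on the right by [f] acts on C[[r]] modulo r^(n.+1); row i of the
   matrix is the image r^i \o f = f^i of the basis vector r^i. *)
Definition comp_mx n (f : Gc R) : 'M[C]_n.+1 :=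
  \matrix_(i, j) (trunc_ps f n ^+ i)`_j.

Lemma coef_trunc0 n (f : Gc R) : (trunc_ps f n)`_0 = 0.
Proof. by rewrite coef_trunc // coef_0. Qed.

Lemma comp_mx1 n : comp_mx n 1%g = 1%:M.
Proof.
apply/matrixP => i j; rewrite !mxE.
transitivity (('X^i : {poly C})`_j); last first.
  by rewrite coefXn -val_eqE /= eq_sym; case: eqP.
apply: (eqm_exp (n := n)); last by rewrite -ltnS.
by move=> k kn; rewrite coef_trunc // coefX.
Qed.

(** Row [i] of the left side is [f^i \o g], the combination of the powers of [g] with the
    coefficients of [f^i]. *)
Lemma comp_mxM n (f g : Gc R) : comp_mx n (f * g)%g = comp_mx n f *m comp_mx n g.
Proof.
apply/matrixP => i j; rewrite !mxE; have jn : (j <= n)%N by rewrite -ltnS.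
transitivity ((trunc_ps f n ^+ i \Po trunc_ps g n)`_j).
  rewrite rmorphXn /=; apply: (eqm_exp (n := n)) => // k kn.
  by rewrite coef_trunc // -comp_ps_poly // coef_0.
rewrite (Defs.comp_polyE _ (coef_trunc0 n g) jn).
by apply: eq_bigr => k _; rewrite !mxE.
Qed.

Lemma coef_exp_diag (p : {poly C}) k : p`_0 = 0 -> p`_1 = 1 -> (p ^+ k)`_k = 1.
Proof.
move=> p0 p1; elim: k => [|k IH]; first by rewrite expr0 coef1.
rewrite exprS coefM !big_ord_recl p0 mul0r add0r /= p1 mul1r /bump /= subn1 /= IH.
rewrite big1 ?addr0 // => i _; rewrite exp_low ?mulr0 //.
by have := ltn_ord i; rewrite /bump /=; lia.
Qed.

(** Each further factor [A] moves the support one more diagonal to the right, until it leaves the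
    matrix. *)
Lemma strict_upper_nilpotent n (A : 'M[C]_n) :
  (forall i j : 'I_n, (j <= i)%N -> A i j = 0) -> A ^+ n = 0.
Proof.
move=> A0; suff AX m (i j : 'I_n) : (j < i + m)%N -> (A ^+ m) i j = 0.
  by apply/matrixP => i j; rewrite AX ?mxE // (leq_trans (ltn_ord j)) ?leq_addl.
elim: m i j => [|m IH] i j; rewrite ?addn0 => ij.
  by rewrite expr0 mxE -val_eqE gtn_eqF.
rewrite exprS -mulmxE mxE big1 // => k _.
have [ki|ik] := leqP k i; first by rewrite A0 ?mul0r.
by rewrite IH ?mulr0 // (leq_trans ij) // addnS -addSn leq_add2r.
Qed.

Lemma comp_mx_unipotent n (f : Gc R) : unipotent (comp_mx n f).
Proof.
(* Modulo [r] the linear coefficient is lost, so [coef_exp_diag] does not apply; the matrix is then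
   the 1 by 1 identity. *)
case: n => [|n].
  by exists 1%N; apply: strict_upper_nilpotent => i j _; rewrite !mxE !ord1 expr0 coef1 subrr.
exists n.+2; apply: strict_upper_nilpotent => i j; rewrite leq_eqVlt !mxE => /predU1P[ji|ji].
  have -> : j = i by exact/val_inj.
  by rewrite eqxx coef_exp_diag ?subrr // coef_trunc // ?coef_0 ?coef_1.
by rewrite exp_low ?coef_trunc0 // -val_eqE gtn_eqF // subr0.
Qed.

Lemma Gc_residually_torsion_free_nilpotent :
  residually_torsion_free_nilpotent R (Gc R).
Proof.
(* [d_ k.+1] is the coefficient of [r^(k+2)], hence the last entry of row 1 in size [k.+3]. *)
move=> f g /Gc_neq[k fgk]; exists k.+3, (comp_mx k.+2); split.
  by split; [exact: comp_mx1|exact: comp_mxM|exact: comp_mx_unipotent].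
move=> /matrixP/(_ (inord 1) ord_max); rewrite !mxE inordK // !expr1 /=.
by rewrite !coef_trunc.
Qed.

End Representations.

Theorem proposition3p5 (R : realType) :
  [/\ continuous (fun p : Gc R * Gc R => (p.1 * p.2)%g),
      continuous (fun f : Gc R => (f^-1)%g)
    & separable (Gc R)] /\
  (forall f g : Gc R, f <> g -> exists2 k : nat, (1 <= k)%N & d_ k f <> d_ k g) /\
  [/\ contractible_to_point R (Gc R),
      arcwise_connected R [set: Gc R],
      locally_simply_connected R (Gc R),
      locally_arcwise_connected R (Gc R)
    & residually_torsion_free_nilpotent R (Gc R)].
Proof.
split; last split.
- split; first exact: Gc_mul_continuous; first exact: Gc_inv_continuous.
  exact: Gc_separable.
- by move=> f g /Gc_neq[k]; exists k.+1.
- split.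
  + exact: Gc_contractible.
  + by apply: seg_convex_arcwise; exact: setT_seg_convex.
  + by apply: has_base_of_box; exact: seg_convex_simply_connected.
  + by apply: has_base_of_box; exact: seg_convex_arcwise.
  + exact: Gc_residually_torsion_free_nilpotent.
Qed.
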